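(* Let $m\ge 2$, let $n_1,\dots,n_m$ be positive integers, and let $D(K_{n_1,n_2,\cdots,n_m})$ be the distance matrix of the complete $m$-partite graph $K_{n_1,n_2,\cdots,n_m}$, with vertices ordered part by part. If $\det D(K_{n_1,n_2,\cdots,n_m}) \neq 0$, then the inverse in $m\times m$ block form (blocks indexed by the parts, the $(i,j)$ block being of size $n_i\times n_j$) is $D(K_{n_1,n_2,\cdots,n_m})^{-1} = [\widetilde{D}_{ij}]$, where $$\widetilde{D}_{ij}=\begin{cases} \left(\dfrac{2 \beta_{\widehat{n_i}} - \gamma_{\widehat{n_i}}}{2 \beta_{n_1, n_2,\cdots,n_m}} \right)J_{n_i} - \dfrac{1}{2} I_{n_i} & \text{if } i = j,\\[2mm] -\dfrac{\prod_{l \neq i,j}(n_l - 2)}{\beta_{n_1, n_2,\cdots,n_m}}\, J_{n_i \times n_j} & \text{if } i \neq j. \end{cases}$$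
   Context: $K_{n_1,\dots,n_m}$ is the graph whose vertex set is partitioned into $V_1,\dots,V_m$ with $|V_i|=n_i$, two vertices being adjacent if and only if they lie in different parts. The distance matrix has entries the graph distances. $I_n$ is the identity matrix, $J_{p\times q}$ is the $p\times q$ all-ones matrix, $J_n=J_{n\times n}$. For positive integers $n_1,\dots,n_k$ put $$\gamma_{n_1,\dots,n_k}=\sum_{i=1}^k n_i\prod_{j\ne i}(n_j-2),\qquad \beta_{n_1,\dots,n_k}=\gamma_{n_1,\dots,n_k}+\prod_{i=1}^k(n_i-2),$$ and $\beta_{\widehat{n_i}}=\beta_{n_1,\dots,n_{i-1},n_{i+1},\dots,n_m}$, $\gamma_{\widehat{n_i}}=\gamma_{n_1,\dots,n_{i-1},n_{i+1},\dots,n_m}$ (the index $n_i$ omitted). Empty products equal $1$. *)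

(* Defs.v *)
From mathcomp Require Import all_boot all_order all_algebra.
Set Implicit Arguments.
Unset Strict Implicit.
Unset Printing Implicit Defensive.
Import GRing.Theory.
Local Open Scope ring_scope.

Section GraphDistance.
Variables (T : finType) (e : rel T).

Definition walk (u v : T) (k : nat) : bool :=
  [exists p : k.-tuple T, path e u p && (last u p == v)].

(* The least length of a walk from u to v. A shortest walk repeats no vertex,
   so it has length less than #|T|; the value is #|T| when v is not reachable
   from u. *)
Definition graph_dist (u v : T) : nat := find (walk u v) (iota 0 #|T|).

End GraphDistance.

(* K_{n_0,...,n_(m-1)}. The vertices are numbered part by part, and
   tagnat.sig1 u : 'I_m is the part containing the vertex u; this is the block
   decomposition of indices used by \mxblock and submxblock. *)
Definition complete_multipartite m (n : 'I_m -> nat) : rel 'I_(\sum_i n i) :=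
  fun u v => tagnat.sig1 u != tagnat.sig1 v.
Arguments complete_multipartite {m} n.

Definition multipartite_distance_mx (R : pzSemiRingType) m (n : 'I_m -> nat) :
    'M[R]_(\sum_i n i) :=
  \matrix_(u, v) (graph_dist (complete_multipartite n) u v)%:R.

(* The values n_j - 2 are taken in the ring R, not in nat. *)
Definition gamma (R : comPzRingType) k (n : 'I_k -> nat) : R :=
  \sum_i ((n i)%:R * \prod_(j | j != i) ((n j)%:R - 2)).

Definition beta (R : comPzRingType) k (n : 'I_k -> nat) : R :=
  gamma R n + \prod_i ((n i)%:R - 2).

Definition omit m (n : 'I_m -> nat) (i : 'I_m) : 'I_m.-1 -> nat :=
  fun j => n (lift i j).

(* Main.v *)
Require Import Defs.
From mathcomp Require Import all_boot all_order all_algebra.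
From mathcomp Require Import ring.
Set Implicit Arguments.
Unset Strict Implicit.
Unset Printing Implicit Defensive.
Import GRing.Theory.
Local Open Scope ring_scope.

(** Distinct vertices of a complete multipartite graph with at least two
    nonempty parts are at distance 1 if their parts differ and 2 if they agree,
    so the distance matrix has entries
    [D u v = 1 + [part u = part v] - 2 [u = v]]
    ([multipartite_distance_mxE]). It therefore maps a vector that takes the
    constant value [f k] on each part [k] to the one with value
    [(n i - 2) f i + \sum_k n k * f k] on part [i]
    ([distance_mx_part_const]): everything reduces to a system indexed by the
    parts, a diagonal matrix plus a matrix of rank one.

    [beta] is the determinant of the reduced system. If it vanishes, the
    reduced system has an explicit null vector, which lifts to a null vector of
    [D]; hence [beta != 0] when [D] is invertible ([beta_neq0]).

    The column of the claimed inverse at a vertex [v] of part [j] is a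
    part-constant vector with values [a i j] minus half of the indicator of
    [v]. Since [D] sends the indicator of [v] to its own column, the terms
    [2 [u = v]] of that column already produce the identity matrix, and the
    remaining requirement is the reduced system
    [(n i - 2) a i j + \sum_k n k * a k j = (1 + [i = j]) / 2].
    The stated coefficients solve it ([inverse_coef_system]): this follows from
    expanding [gamma] and [beta] along part [j] as affine functions of [n j]
    ([beta_expand]). *)

(** * Distances in a complete multipartite graph *)

Lemma graph_dist_least (T : finType) (e : rel T) (u v : T) (k : nat) :
  (k <= #|T|)%N -> walk e u v k -> (forall j, (j < k)%N -> ~~ walk e u v j) ->
  graph_dist e u v = k.
Proof.
move=> le_kT walk_k not_walk; rewrite /graph_dist.
set s := iota 0 _; have size_s : size s = #|T| by rewrite size_iota.
have [lt_fk | lt_kf | //] := ltngtP (find (walk e u v) s) k.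
  have lt_fT := leq_trans lt_fk le_kT.
  have: has (walk e u v) s by rewrite has_find size_s.
  move/(nth_find 0%N); rewrite nth_iota // add0n.
  by rewrite (negPf (not_walk _ lt_fk)).
have lt_kT: (k < #|T|)%N by rewrite -size_s (leq_trans lt_kf) ?find_size.
by have := before_find 0%N lt_kf; rewrite nth_iota // add0n walk_k.
Qed.

Lemma walk0 (T : finType) (e : rel T) (u v : T) : walk e u v 0 = (u == v).
Proof.
apply/existsP/idP => [[p] | uv]; first by rewrite tuple0.
by exists [tuple].
Qed.

Lemma walk1 (T : finType) (e : rel T) (u v : T) : walk e u v 1 = e u v.
Proof.
apply/existsP/idP => [[[[|w [|//]] //= _]] | euv].
  by rewrite andbT => /andP[euw /eqP<-].
by exists [tuple v]; rewrite /= euv eqxx.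
Qed.

Lemma walk2 (T : finType) (e : rel T) (u w v : T) :
  e u w -> e w v -> walk e u v 2.
Proof.
by move=> euw ewv; apply/existsP; exists [tuple w; v]; rewrite /= euw ewv eqxx.
Qed.

Section DistanceMatrix.

Variables (m : nat) (n : 'I_m -> nat).
Hypotheses (m_gt1 : (1 < m)%N) (n_gt0 : forall i, (0 < n i)%N).

Local Notation part := tagnat.sig1.
Local Notation V := 'I_(\sum_i n i).

(** Two vertices of the same part are joined by a walk of length 2 through any
    other part, and such a part exists and is inhabited because there are at
    least two nonempty parts. *)
Lemma graph_dist_multipartite (u v : V) :
  graph_dist (complete_multipartite n) u v =
    if u == v then 0%N else if part u == part v then 2 else 1%N.
Proof.
have [<-{v} | neq_uv] := eqVneq.
  by apply: graph_dist_least; rewrite ?walk0.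
have cardV : (1 < #|V|)%N by apply/card_gt1P; exists u, v.
have [eq_part | neq_part] := eqVneq.
  apply: graph_dist_least => //.
    have [k neq_k] : exists k : 'I_m, k != part u.
      have /card_gt1P[i [j [_ _ neq_ij]]] : (1 < #|'I_m|)%N by rewrite card_ord.
      have [eq_i | ] := eqVneq i (part u); last by exists i.
      by exists j; rewrite -eq_i eq_sym.
    apply: (@walk2 _ _ u (tagnat.Rank k (Ordinal (n_gt0 k)))) => /=.
      by rewrite /complete_multipartite tagnat.Rank1K eq_sym.
    by rewrite /complete_multipartite tagnat.Rank1K -eq_part.
  case=> [|[|//]] _; first by rewrite walk0.
  by rewrite walk1 /complete_multipartite eq_part eqxx.
apply: graph_dist_least; first exact: ltnW.
  by rewrite walk1.
by case=> // _; rewrite walk0.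
Qed.

Lemma multipartite_distance_mxE (R : pzRingType) (u v : V) :
  multipartite_distance_mx R n u v =
    1 + (part u == part v)%:R - 2 * (u == v)%:R.
Proof.
rewrite mxE graph_dist_multipartite.
have [-> | _] := eqVneq u v; first by rewrite eqxx mulr1 subrr.
by rewrite mulr0 subr0; case: eqP; rewrite ?addr0.
Qed.

Lemma sum_over_parts (R : pzSemiRingType) (f : 'I_m -> R) :
  \sum_(w : V) f (part w) = \sum_k (n k)%:R * f k.
Proof.
rewrite (reindex tagnat.rank) /=; last exact: onW_bij tagnat.rank_bij.
under eq_bigr => p _ do rewrite /tagnat.sig1 tagnat.rankK.
transitivity (\sum_k \sum_(i < n k) f k); first by rewrite sig_big_dep.
by apply: eq_bigr => k _; rewrite sumr_const card_ord mulr_natl.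
Qed.

(** Vectors constant on the parts form an invariant subspace of the distance
    matrix, on which it acts as a diagonal matrix plus a matrix of rank one. *)
Lemma distance_mx_part_const (R : comPzRingType) (f : 'I_m -> R) (u : V) :
  \sum_w multipartite_distance_mx R n u w * f (part w) =
    ((n (part u))%:R - 2) * f (part u) + \sum_k (n k)%:R * f k.
Proof.
have same_part : \sum_(w : V) (part u == part w)%:R * f (part w) =
    (n (part u))%:R * f (part u).
  rewrite (sum_over_parts (fun k => (part u == k)%:R * f k)).
  rewrite (bigD1 (part u)) //= eqxx mul1r big1 ?addr0 // => k.
  by rewrite eq_sym => /negPf->; rewrite mul0r mulr0.
have same_vertex : \sum_(w : V) (u == w)%:R * f (part w) = f (part u).
  rewrite (bigD1 u) //= eqxx mul1r big1 ?addr0 // => w.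
  by rewrite eq_sym => /negPf->; rewrite mul0r.
under [LHS]eq_bigr => w _ do
  rewrite multipartite_distance_mxE mulrBl mulrDl mul1r -mulrA.
rewrite sumrB big_split /= -mulr_sumr same_part same_vertex sum_over_parts.
by ring.
Qed.

End DistanceMatrix.

(** * Expanding beta and gamma along one part *)

Lemma big_lift (S : Type) (idx : S) (op : Monoid.com_law idx) m (j : 'I_m)
    (P : pred 'I_m) (F : 'I_m -> S) :
  \big[op/idx]_(i | P (lift j i)) F (lift j i) =
    \big[op/idx]_(k | P k && (k != j)) F k.
Proof.
rewrite [RHS](reindex_omap (lift j) (unlift j)) /=.
  by apply: eq_bigl => i; rewrite liftK eqxx eq_sym neq_lift !andbT.
by move=> k /andP[_]; rewrite eq_sym => /unlift_some[i -> ->].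
Qed.

Section Expansion.

Variables (R : comPzRingType) (m : nat) (n : 'I_m -> nat).

Local Notation x l := ((n l)%:R - 2 : R).

Lemma gamma_omit (j : 'I_m) :
  gamma R (omit n j) =
    \sum_(k | k != j) (n k)%:R * \prod_(l | (l != k) && (l != j)) x l.
Proof.
rewrite /gamma /omit.
rewrite -(@big_lift _ _ _ _ j xpredT
  (fun k => (n k)%:R * \prod_(l | (l != k) && (l != j)) x l)).
apply: eq_bigr => i _; rewrite -big_lift; congr (_ * _).
by apply: eq_bigl => l; rewrite (inj_eq lift_inj).
Qed.

Lemma beta_omit (j : 'I_m) :
  beta R (omit n j) = gamma R (omit n j) + \prod_(l | l != j) x l.
Proof. by rewrite /beta /omit (@big_lift _ _ _ _ j xpredT (fun l => x l)). Qed.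

Lemma gamma_expand (j : 'I_m) :
  gamma R n =
    (n j)%:R * \prod_(l | l != j) x l + x j * gamma R (omit n j).
Proof.
rewrite gamma_omit /gamma (bigD1 j) //=; congr (_ + _).
rewrite mulr_sumr; apply: eq_bigr => k neq_kj.
by rewrite (bigD1 j) 1?eq_sym //= mulrCA.
Qed.

Lemma beta_expand (j : 'I_m) :
  beta R n =
    (2 * (n j)%:R - 2) * \prod_(l | l != j) x l + x j * gamma R (omit n j).
Proof. by rewrite /beta (gamma_expand j) [X in _ + X](bigD1 j) //=; ring. Qed.

End Expansion.

(** * Nonvanishing of beta *)

(** The left-hand side below is the action of the distance matrix on
    part-constant vectors, and it is singular as soon as [beta] vanishes:
    if [c i] is the product of the [n l - 2] over [l != i], then the image of
    [c] is constant with value [beta], so [c] is a null vector. When [c] itself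
    is zero, two of the factors [n l - 2] vanish, and the difference of the
    indicators of the two parts, whose sizes both equal 2 in [R], is a null
    vector. *)
Lemma part_null_vector (R : idomainType) (m : nat) (n : 'I_m -> nat) :
  (0 < m)%N -> beta R n = 0 ->
  exists2 c : 'I_m -> R, (exists i, c i != 0) &
    forall i, ((n i)%:R - 2) * c i + \sum_k (n k)%:R * c k = 0.
Proof.
move=> m_gt0 beta0; pose x i : R := (n i)%:R - 2.
pose c i := \prod_(l | l != i) x l.
have [c0 | /existsP c_neq0] := boolP [forall i, c i == 0]; last first.
  exists c => [|i].
    by have [i ci] := c_neq0; exists i.
  rewrite -[RHS]beta0 /beta addrC; congr (_ + _).
  by rewrite [RHS](bigD1 i).
have exzero i : exists2 l, l != i & x l = 0.
  by move/forallP/(_ i)/prodf_eq0: c0 => [l li /eqP]; exists l.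
have [a _ xa] := exzero (Ordinal m_gt0).
have [b neq_ba xb] := exzero a.
have nx k : x k = 0 -> (n k)%:R = 2 :> R by move/eqP; rewrite subr_eq0 => /eqP.
exists (fun k => (k == a)%:R - (k == b)%:R) => [|i].
  by exists a; rewrite eqxx (eq_sym a) (negPf neq_ba) subr0 oner_neq0.
rewrite [X in _ + X](_ : _ = 0) => [|].
  rewrite addr0 -/(x i); have [-> | _] := eqVneq i a; first by rewrite xa mul0r.
  have [-> | _] := eqVneq i b; first by rewrite xb mul0r.
  by rewrite subrr mulr0.
rewrite (bigD1 a) //= (bigD1 b) //= big1 => [|k /andP[/negPf-> /negPf->]].
  rewrite !eqxx (negPf neq_ba) (eq_sym a b) (negPf neq_ba) (nx a) ?(nx b) //.
  by ring.
by rewrite subrr mulr0.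
Qed.

Lemma beta_neq0 (R : fieldType) (m : nat) (n : 'I_m -> nat) :
  (1 < m)%N -> (forall i, (0 < n i)%N) ->
  \det (multipartite_distance_mx R n) != 0 -> beta R n != 0.
Proof.
move=> m_gt1 n_gt0 detD; apply/eqP => /(part_null_vector (ltnW m_gt1)).
case=> c [i ci] Dc0.
pose v : 'cV[R]_(\sum_i n i) := \col_w c (tagnat.sig1 w).
have Dv0 : multipartite_distance_mx R n *m v = 0.
  apply/colP => u; rewrite !mxE -[RHS](Dc0 (tagnat.sig1 u)).
  rewrite -distance_mx_part_const //.
  by apply: eq_bigr => w _; rewrite [v _ _]mxE.
have v0 : v = 0.
  have unitD : multipartite_distance_mx R n \in unitmx by rewrite unitmxE unitfE.
  by rewrite -(mulKmx unitD v) Dv0 mulmx0.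
move/colP/(_ (tagnat.Rank i (Ordinal (n_gt0 i)))): v0.
by rewrite !mxE tagnat.Rank1K => ci0; rewrite ci0 eqxx in ci.
Qed.

(** * The inverse *)

Definition inverse_coef (R : fieldType) m (n : 'I_m -> nat) (i j : 'I_m) : R :=
  if i == j then
    (2 * beta R (omit n i) - gamma R (omit n i)) / (2 * beta R n)
  else - (\prod_(l < m | (l != i) && (l != j)) ((n l)%:R - 2) / beta R n).

(** The [j]-th column of coefficients solves the reduced linear system on the
    parts. Both cases follow from expanding [beta] along part [j], because the
    off-diagonal entries contribute exactly [- gamma (omit n j) / beta n] to
    the weighted column sum. *)
Lemma inverse_coef_system (R : numFieldType) m (n : 'I_m -> nat) (i j : 'I_m) :
  beta R n != 0 ->
  ((n i)%:R - 2) * inverse_coef R n i j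
    + \sum_k (n k)%:R * inverse_coef R n k j = (1 + (i == j)%:R) / 2.
Proof.
move=> beta_n0.
have col_sum : \sum_(k | k != j) (n k)%:R * inverse_coef R n k j =
    - (gamma R (omit n j) / beta R n).
  rewrite gamma_omit mulr_suml -sumrN; apply: eq_bigr => k /negPf neq_kj.
  by rewrite /inverse_coef neq_kj mulrN mulrA.
rewrite (bigD1 j) //= col_sum {col_sum} /inverse_coef eqxx.
move: beta_n0; rewrite (beta_expand R n j) (beta_omit R n j).
have [-> beta_n0 | neq_ij beta_n0] := eqVneq i j; rewrite ?mulr1n ?mulr0n.
  by rewrite beta_omit; field; rewrite beta_n0.
set X := \prod_(l | l != j) _ in beta_n0 *.
(* The factor [n i - 2] completes the product over the parts other than [j]. *)
have complete :
    ((n i)%:R - 2) * \prod_(l < m | (l != i) && (l != j)) ((n l)%:R - 2) = X.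
  rewrite /X [RHS](bigD1 i) //=; congr (_ * _).
  by apply: eq_bigl => l; rewrite andbC.
rewrite mulrN mulrA complete.
by field; rewrite beta_n0.
Qed.

(** The half of the identity in the inverse is what turns the term
    [2 (u == v)] of the distance matrix into the identity matrix; the rest of
    the product is the reduced system. *)
Lemma invmx_multipartite_distance_mx (R : numFieldType) m (n : 'I_m -> nat)
    (u v : 'I_(\sum_i n i)) :
  (1 < m)%N -> (forall i, (0 < n i)%N) ->
  \det (multipartite_distance_mx R n) != 0 ->
  invmx (multipartite_distance_mx R n) u v =
    inverse_coef R n (tagnat.sig1 u) (tagnat.sig1 v) - (1 / 2) * (u == v)%:R.
Proof.
move=> m_gt1 n_gt0 detD; have beta_n0 := beta_neq0 m_gt1 n_gt0 detD.
pose E : 'M[R]_(\sum_i n i) := \matrix_(u, v)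
  (inverse_coef R n (tagnat.sig1 u) (tagnat.sig1 v) - (1 / 2) * (u == v)%:R).
suff -> : invmx (multipartite_distance_mx R n) = E by rewrite mxE.
have unitD : multipartite_distance_mx R n \in unitmx by rewrite unitmxE unitfE.
suff DE : multipartite_distance_mx R n *m E = 1%:M.
  by rewrite -(mulKmx unitD E) DE mulmx1.
apply/matrixP => {}u {}v; rewrite [LHS]mxE [RHS]mxE.
have column : \sum_w multipartite_distance_mx R n u w * (w == v)%:R =
    multipartite_distance_mx R n u v.
  rewrite (bigD1 v) //= eqxx mulr1 [X in _ + X]big1 ?addr0 // => w /negPf->.
  exact: mulr0.
under [LHS]eq_bigr => w _ do rewrite [E _ _]mxE mulrBr mulrCA.
rewrite sumrB -mulr_sumr column.
rewrite (distance_mx_part_const m_gt1 n_gt0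
  (fun k => inverse_coef R n k (tagnat.sig1 v))) inverse_coef_system //.
rewrite multipartite_distance_mxE //.
by field.
Qed.

Theorem theorem3p3 (R : numFieldType) (m : nat) (n : 'I_m -> nat)
    (hm : (2 <= m)%N) (hn : forall i, (0 < n i)%N)
    (hD : \det (multipartite_distance_mx R n) != 0) :
  (forall i : 'I_m,
     submxblock (invmx (multipartite_distance_mx R n)) i i =
       ((2 * beta R (omit n i) - gamma R (omit n i)) / (2 * beta R n))
         *: const_mx 1 - (1 / 2) *: 1%:M) /\
  (forall i j : 'I_m, i != j ->
     submxblock (invmx (multipartite_distance_mx R n)) i j =
       - (\prod_(l < m | (l != i) && (l != j)) ((n l)%:R - 2) / beta R n)
         *: const_mx 1).
Proof.
split=> [i | i j /negPf neq_ij]; apply/matrixP => k l.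
  rewrite !mxE invmx_multipartite_distance_mx // !tagnat.Rank1K.
  by rewrite /inverse_coef eqxx mulr1 -val_eqE /= tagnat.eq_Rank eqxx.
rewrite !mxE invmx_multipartite_distance_mx // !tagnat.Rank1K.
rewrite /inverse_coef neq_ij mulr1 -val_eqE /= tagnat.eq_Rank neq_ij.
by rewrite mulr0 subr0.
Qed.
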